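(* Let $(X,\tau,g)$ be a $\Sigma_g$-semicomplete space. Let the function $f:X\to\mathbb{R}\cup\{+\infty\}$ be proper, lower semicontinuous and bounded below. Then for every $\varepsilon>0$ there exists $v\in X$ such that $$f(v)\le f(x)+\varepsilon g(x,v)\quad\text{for all }x\in X.$$
   Context: $\mathbb{R}^+=[0,\infty)$. A premetric space $(X,\tau,g)$ is a first countable topological space $(X,\tau)$ with a premetric function $g:X\times X\to\mathbb{R}^+$, i.e. (P1) $g(x,x)=0$ for all $x\in X$ and $g(x,y)>0$ whenever $x\neq y$; (P2) $g(x,\cdot)$ is continuous for every fixed $x\in X$. (No symmetry or triangle inequality is assumed.) A sequence $\{x_n\}_{n\ge0}$ in $X$ is $\Sigma_g$-Cauchy if its $g$-length $\sum_{i=0}^\infty g(x_{i+1},x_i)$ is finite. $(X,\tau,g)$ is called $\Sigma_g$-semicomplete if it is a first countable premetric space in which every $\Sigma_g$-Cauchy sequence has a convergent subsequence. Proper means $f$ is not identically $+\infty$. *)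

(* Defs.v *)
From HB Require Import structures.
From mathcomp Require Import all_boot all_order all_algebra.
From mathcomp Require Import all_classical all_reals all_analysis.

Set Implicit Arguments.
Unset Strict Implicit.
Unset Printing Implicit Defensive.

Import Order.TTheory GRing.Theory Num.Theory.
Import numFieldNormedType.Exports.

Local Open Scope classical_set_scope.
Local Open Scope ring_scope.

Definition first_countable (X : topologicalType) : Prop :=
  forall x : X, exists B : set (set X),
    [/\ countable B,
        forall V, B V -> nbhs x V
      & forall U, nbhs x U -> exists2 V, B V & V `<=` U].

(* The first clause encodes the codomain [0, +oo[ of g. *)
Definition premetric (R : realType) (X : topologicalType) (g : X -> X -> R)
    : Prop :=
  [/\ forall x y, 0 <= g x y,
      forall x, g x x = 0,
      forall x y, x <> y -> 0 < g x y
    & forall x, continuous (g x)].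

Definition premetric_space (R : realType) (X : topologicalType)
    (g : X -> X -> R) : Prop :=
  first_countable X /\ premetric g.

(* Computed in \bar R, where a series of nonnegative terms always has a sum;
   g need not be symmetric, so the order of the arguments matters. *)
Definition g_length (R : realType) (X : topologicalType) (g : X -> X -> R)
    (u : nat -> X) : \bar R :=
  (\sum_(0 <= i <oo) (g (u i.+1) (u i))%:E)%E.

Definition sigma_cauchy (R : realType) (X : topologicalType)
    (g : X -> X -> R) (u : nat -> X) : Prop :=
  (g_length g u < +oo)%E.

(* Limits need not be unique in X (no separation axiom is assumed), and X may
   be empty, hence an explicit limit point instead of `lim`. *)
Definition has_convergent_subsequence (X : topologicalType) (u : nat -> X)
    : Prop :=
  exists phi : nat -> nat, increasing_seq phi /\
    exists l : X, (fun n => u (phi n)) @ \oo --> l.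

Definition sigma_semicomplete (R : realType) (X : topologicalType)
    (g : X -> X -> R) : Prop :=
  premetric_space g /\
  forall u : nat -> X, sigma_cauchy g u -> has_convergent_subsequence u.

(* Main.v *)
Require Import Defs.
From HB Require Import structures.
From mathcomp Require Import all_boot all_order all_algebra.
From mathcomp Require Import all_classical all_reals all_analysis.

(* Argue by contradiction: suppose every v admits a descent point x, that is,
   f x + eps * g x v < f v.  Starting from a point where f is finite, let
   u (n+1) minimise f, up to 1/(n+1), over the descent points of u n.  The
   lengths telescope, so u is Sigma_g-Cauchy and has a subsequence converging
   to some l, and f l <= f (u n) for all n by lower semicontinuity.  Let x be a
   descent point of l.  Since g x is continuous, x is also a descent point of
   u n for n far along the subsequence; near-minimality then gives
   f l <= f (u (n+1)) <= f x + 1/(n+1), and in the limit f l <= f x < f l. *)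

Set Implicit Arguments.
Unset Strict Implicit.
Unset Printing Implicit Defensive.

Import Order.TTheory GRing.Theory Num.Theory.
Import numFieldNormedType.Exports.

Local Open Scope classical_set_scope.
Local Open Scope ring_scope.

(** The bound [m] rules out an infimum of [-oo]. A finite infimum is approached within [d]; if it is
    [+oo], then [f] is [+oo] on [P] and any point serves. *)
Lemma approx_minimizer (R : realType) (T : Type) (f : T -> \bar R) (P : set T)
    (m d : R) :
  P !=set0 -> (forall x, P x -> (m%:E <= f x)%E) -> 0 < d ->
  exists2 w, P w & forall x, P x -> (f w <= f x + d%:E)%E.
Proof.
move=> [p Pp] fm d0.
have inf_le x : P x -> (ereal_inf (f @` P) <= f x)%E.
  by move=> Px; apply: ereal_inf_lbound; exists x.
have [inf_fin|inf_nfin] := boolP (ereal_inf (f @` P) \is a fin_num).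
  have [_ [w Pw <-] fw] := lb_ereal_inf_adherent d0 inf_fin.
  exists w => // x Px; apply: (le_trans (ltW fw)).
  by rewrite leeD2r// inf_le.
have infy : ereal_inf (f @` P) = +oo%E.
  have : (m%:E <= ereal_inf (f @` P))%E.
    by apply/ereal_infP => _ [x Px <-]; exact: fm.
  by move: inf_nfin; case: (ereal_inf _).
exists p => // x Px; move: (inf_le _ Px).
by rewrite infy leye_eq => /eqP ->; rewrite addye ?leey.
Qed.

Lemma lower_semicontinuous_cvg_le (R : realType) (X : topologicalType)
    (f : X -> \bar R) (T : Type) (F : set_system T) (FF : ProperFilter F)
    (u : T -> X) (l : X) (a : R) :
  lower_semicontinuous f -> u @ F --> l ->
  (\forall t \near F, (f (u t) <= a%:E)%E) -> (f l <= a%:E)%E.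
Proof.
move=> lscf ul fua; rewrite leNgt; apply/negP => /lscf[V lV Vf].
have uV : \forall t \near F, V (u t) by exact: ul.
have [t [/Vf + ]] := filter_ex (filterI uV fua).
by move=> /lt_le_trans h /h; rewrite ltxx.
Qed.

Lemma increasing_seq_cvgn (phi : nat -> nat) :
  increasing_seq phi -> phi @ \oo --> \oo.
Proof.
move=> /increasing_seqP phiS A [N _ NA]; exists N => // k /= Nk.
apply: NA => /=; apply: (leq_trans Nk); elim: k {Nk} => // k IHk.
exact: leq_ltn_trans IHk (phiS k).
Qed.

(** Summing the descent inequality telescopes: every partial length is at most [(h 0 - h n) / eps],
    hence at most [(h 0 - m) / eps]. *)
Lemma sigma_cauchy_descent (R : realType) (X : topologicalType)
    (g : X -> X -> R) (u : nat -> X) (h : nat -> R) (m eps : R) :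
  (forall x y, 0 <= g x y) -> 0 < eps -> (forall n, m <= h n) ->
  (forall n, h n.+1 + eps * g (u n.+1) (u n) <= h n) -> sigma_cauchy g u.
Proof.
move=> g0 eps0 mh hS; rewrite /sigma_cauchy /g_length.
apply: (@le_lt_trans _ _ (eps^-1 * (h 0 - m))%:E); last exact: ltry.
apply: lime_le; first by apply: is_cvg_nneseries => n _ _; rewrite lee_fin.
apply: nearW => n; rewrite sumEFin lee_fin ler_pdivlMl//.
apply: (@le_trans _ _ (h 0 - h n)); last by rewrite lerD2l lerN2.
rewrite -opprB -telescope_sumr// mulr_sumr -sumrN ler_sum// => i _.
by rewrite opprB lerBrDl.
Qed.

Theorem theorem3p9 (R : realType) (X : topologicalType) (g : X -> X -> R)
    (f : X -> \bar R)
    (hX : sigma_semicomplete g)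
    (f_codomain : forall x, f x <> -oo%E)
    (f_proper : exists x, f x <> +oo%E)
    (f_lsc : lower_semicontinuous f)
    (f_bounded_below : exists m : R, forall x, (m%:E <= f x)%E)
    (eps : R) (eps_gt0 : 0 < eps) :
  exists v : X, forall x : X, (f v <= f x + (eps * g x v)%:E)%E.
Proof.
case: hX => -[_ [g0 _ _ gC]] semicomplete.
case: f_proper => x0 fx0; case: f_bounded_below => m fm.
apply: contrapT => noV.
pose descent v := [set x | (f x + (eps * g x v)%:E < f v)%E].
have descent0 v : descent v !=set0.
  apply: contrapT => Dv; apply: noV; exists v => x; rewrite leNgt.
  by apply/negP => Dx; apply: Dv; exists x.
(* The choice function takes the index along with the point, so that the tolerance can shrink from
   stage to stage. *)
have /choice[next nextP] : forall nv : nat * X, exists w, descent nv.2 w /\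
    forall x, descent nv.2 x -> (f w <= f x + (nv.1.+1%:R^-1)%:E)%E.
  case=> n v /=.
  have [|w Dw wmin] := @approx_minimizer _ _ f _ m n.+1%:R^-1 (descent0 v)
    (fun x _ => fm x); first by rewrite invr_gt0.
  by exists w.
have [u [u0 uS]] : exists u : nat -> X,
    u 0%N = x0 /\ forall n, u n.+1 = next (n, u n).
  by exists (fix u n := if n is k.+1 then next (k, u k) else x0).
have uD n : descent (u n) (u n.+1) by rewrite uS; case: (nextP (n, u n)).
have umin n x : descent (u n) x -> (f (u n.+1) <= f x + (n.+1%:R^-1)%:E)%E.
  by rewrite uS; case: (nextP (n, u n)) => _; exact.
(* A value [+oo] at [x] would make the strict descent inequality fail, whatever [f v] is. *)
have fin_descent v x : descent v x -> f x \is a fin_num.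
  rewrite /descent /=; move: (f_codomain x).
  by case: (f x) => // _; rewrite addye// ltNge leey.
have ufin n : f (u n) \is a fin_num.
  case: n => [|n]; last exact: fin_descent (uD n).
  by rewrite u0 fin_numE; apply/andP; split; exact/eqP.
pose h n := fine (f (u n)).
have fu n : f (u n) = (h n)%:E by rewrite fineK.
have hD n : h n.+1 + eps * g (u n.+1) (u n) < h n.
  by have := uD n; rewrite /descent /= !fu -EFinD lte_fin.
have hdecr : nonincreasing_seq h.
  apply/nonincreasing_seqP => n; apply: le_trans (ltW (hD n)).
  by rewrite lerDl mulr_ge0// ltW.
have [|phi [phi_incr [l ul]]] := semicomplete u.
  apply: (@sigma_cauchy_descent _ _ _ _ h m eps) => // n.
  - by rewrite -lee_fin -fu.
  - exact: ltW.
have phioo := increasing_seq_cvgn phi_incr.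
(* The subsequence eventually passes index [n], and [h] is nonincreasing; so the bound holds for
   every [n], not only along [phi]. *)
have fl n : (f l <= (h n)%:E)%E.
  apply: (lower_semicontinuous_cvg_le _ f_lsc ul).
  have : \forall k \near \oo, (n <= phi k)%N by exact: phioo (nbhs_infty_ge n).
  by apply: filterS => k nk; rewrite fu lee_fin hdecr.
have [x xD] := descent0 l.
have flfin : f l \is a fin_num.
  rewrite fin_numE; apply/andP; split; first exact/eqP.
  by rewrite -ltey; apply: le_lt_trans (fl 0%N) _; rewrite ltry.
have xfin := fin_descent _ _ xD.
have fxl : fine (f x) + eps * g x l < fine (f l).
  by move: xD; rewrite /descent /= -(fineK xfin) -(fineK flfin) -EFinD lte_fin.
have flh n : fine (f l) <= h n by rewrite -lee_fin fineK.
(* The strict inequality at [l] persists nearby because [x] is the fixed first argument of [g]; then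
   [f l] is replaced by the larger [h (phi k)]. *)
have xDu : \forall k \near \oo, descent (u (phi k)) x.
  have gxl : fine (f x) + eps * g x (u (phi k)) @[k --> \oo]
      --> fine (f x) + eps * g x l.
    apply: cvgD; first exact: cvg_cst.
    by apply: cvgMr; apply: (cvg_comp _ _ ul); exact: gC.
  apply: filterS (cvgr_lt _ gxl _ fxl) => k xk.
  rewrite /descent /= -(fineK xfin) fu -EFinD lte_fin.
  exact: lt_le_trans xk (flh _).
have xl : fine (f x) < fine (f l).
  by apply: le_lt_trans fxl; rewrite lerDl mulr_ge0// ltW.
have phi_harmonic : (phi k).+1%:R^-1 @[k --> \oo] --> (0 : R).
  exact: (cvg_comp _ _ phioo (@cvg_harmonic R)).
have small : \forall k \near \oo, (phi k).+1%:R^-1 < fine (f l) - fine (f x).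
  by apply: (cvgr_lt _ phi_harmonic); rewrite subr_gt0.
(* A single [k] suffices: once the tolerance is below the gap [f l - f x], near-minimality puts
   [h (phi k).+1] strictly below [f l], against [flh]. *)
have [k [/umin + ]] := filter_ex (filterI xDu small).
rewrite fu -(fineK xfin) -EFinD lee_fin => hk.
by rewrite ltrBrDl => /(le_lt_trans hk); rewrite ltNge flh.
Qed.
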